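(* Let $k\ge4$ be even and let $G$ be a simple graph. Then, as sets (regardless of multiplicities): (a) the spectrum of $\mathcal{A}(G^{k,\frac{k}{2}})$ equals the union of the sets of eigenvalues of the matrices $\mathcal{A}^{\mathcal{E}}(G[U])=\mathcal{E}A(G[U])\mathcal{E}$ over all $U\subseteq V(G)$ with $G[U]$ connected and all diagonal $\mathcal{E}=\mathrm{diag}\{e^{\mathrm{i}2\pi\ell_u/k}:u\in U\}$, $\ell_u\in\{0,\dots,k-1\}$; (b) the spectrum of $\mathcal{Q}(G^{k,\frac{k}{2}})$ equals the union of the sets of eigenvalues of the matrices $\mathcal{Q}^{\mathcal{E}}(G^o[U])=D(G)[U]+\mathcal{E}A(G[U])\mathcal{E}$ over all $U\subseteq V(G)$ with $G^o[U]$ connected and all such $\mathcal{E}$; (c) the $H$-spectrum of $\mathcal{A}(G^{k,\frac{k}{2}})$ equals the union of the sets of eigenvalues of $A(G[U])$ over all $U$ with $G[U]$ connected; (d) the $H$-spectrum of $\mathcal{Q}(G^{k,\frac{k}{2}})$ equals the union of the sets of eigenvalues of $Q(G^o[U])=D(G)[U]+A(G[U])$ over all $U$ with $G^o[U]$ connected.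
   Context: Tensors: for a real order-$k$, dimension-$n$ tensor $\mathcal{T}$ and $x\in\mathbb{C}^n$, $(\mathcal{T}x^{k-1})_i=\sum_{i_2,\dots,i_k}t_{ii_2\dots i_k}x_{i_2}\cdots x_{i_k}$; $\lambda\in\mathbb{C}$ is an eigenvalue with eigenvector $x\ne0$ if $\mathcal{T}x^{k-1}=\lambda x^{[k-1]}$, $x^{[k-1]}=(x_i^{k-1})_i$; an eigenvalue with a real eigenvector is an $H$-eigenvalue. Spectrum = set of eigenvalues, $H$-spectrum = set of $H$-eigenvalues. Hypergraphs: degree $d_v$ = number of edges containing $v$. For a $k$-uniform hypergraph on $v_1,\dots,v_n$, the adjacency tensor $\mathcal{A}$ has $a_{i_1\dots i_k}=\frac{1}{(k-1)!}$ if $\{v_{i_1},\dots,v_{i_k}\}$ is an edge, else $0$; $\mathcal{D}$ diagonal with $d_{i\dots i}=d_{v_i}$; signless Laplacian tensor $\mathcal{Q}=\mathcal{D}+\mathcal{A}$. For a graph $G$: $A(\cdot)$ adjacency matrix, $D(G)$ diagonal degree matrix, $D(G)[U]$ its principal submatrix on $U$; $G[U]$ is the induced subgraph on $U$, and the modified induced subgraph $G^o[U]$ is $G[U]$ together with $d_v(G)-d_v(G[U])$ loops (one-vertex edges) at each $v\in U$; it is connected if $G[U]$ is connected. Generalized power $G^{k,\frac{k}{2}}$ ($k\ge4$ even): replace each vertex $v$ of $G$ by a set $\mathbf{v}$ of $\frac{k}{2}$ vertices containing $v$ (pairwise disjoint), and for each edge $\{u,v\}$ of $G$ take $\mathbf{u}\cup\mathbf{v}$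 as an edge. *)

(* Defs.v *)
From HB Require Import structures.
From mathcomp Require Import all_boot all_order all_algebra.
From mathcomp Require Import mathcomp_extra boolp classical_sets reals trigo.
From mathcomp Require Import complex.

Set Implicit Arguments.
Unset Strict Implicit.
Unset Printing Implicit Defensive.

Import Order.TTheory GRing.Theory Num.Theory.

Local Open Scope ring_scope.
Local Open Scope complex_scope.

(** Tensors: the index set {1, ..., n} is an arbitrary finite type [I] (below,
    the vertex set itself), and [T t] is the entry at the multi-index [t]. *)

Definition tensor (R : Type) (k : nat) (I : finType) := {ffun k.-tuple I -> R}.

(* (T x^{k-1})_i: the multi-indices are the t = (i, i_2, ..., i_k). *)
Definition tensor_app (R : realType) (k : nat) (I : finType)
    (T : tensor R k I) (x : {ffun I -> R[i]}) : {ffun I -> R[i]} :=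
  [ffun i => \sum_(t : k.-tuple I | ohead t == Some i)
               (T t)%:C * \prod_(j <- behead t) x j].

Definition tensor_eigenpair (R : realType) (k : nat) (I : finType)
    (T : tensor R k I) (lam : R[i]) (x : {ffun I -> R[i]}) : Prop :=
  x != 0 /\ forall i, tensor_app T x i = lam * x i ^+ k.-1.

Definition spectrum (R : realType) (k : nat) (I : finType)
    (T : tensor R k I) : set R[i] :=
  [set lam | exists x, tensor_eigenpair T lam x]%classic.

Definition Hspectrum (R : realType) (k : nat) (I : finType)
    (T : tensor R k I) : set R[i] :=
  [set lam | exists2 x, tensor_eigenpair T lam x
                      & forall i, x i \is Num.real]%classic.

Definition diag_tensor (R : realType) (k : nat) (I : finType) (d : I -> R) :
    tensor R k I :=
  [ffun t : k.-tuple I =>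
     if ohead t is Some i then d i *+ all (pred1 i) t else 0 : R].

(** Hypergraphs, as sets of edges over a finite vertex type. *)

Definition hypergraph (V : finType) := {set {set V}}.

Definition uniform (k : nat) (V : finType) (H : hypergraph V) : Prop :=
  forall e, e \in H -> #|e| = k.

Definition degree (V : finType) (H : hypergraph V) (v : V) : nat :=
  #|[set e in H | v \in e]%SET|.

Definition adjacency_tensor (R : realType) (k : nat) (V : finType)
    (H : hypergraph V) : tensor R k V :=
  [ffun t : k.-tuple V =>
     if [set v in t]%SET \in H then (k.-1)`!%:R^-1 else 0 : R].

Definition signless_laplacian_tensor (R : realType) (k : nat) (V : finType)
    (H : hypergraph V) : tensor R k V :=
  diag_tensor k (fun v => (degree H v)%:R) + adjacency_tensor R k H.

(** Simple graphs. *)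

Record sgraph := SGraph {
  vertex :> finType;
  edge : rel vertex;
  edge_sym : symmetric edge;
  edge_irr : irreflexive edge }.

Arguments edge {s}.

Definition edges (G : sgraph) : hypergraph G :=
  [set [set p.1; p.2] | p : G * G & edge p.1 p.2]%SET.

Definition connected (G : sgraph) : bool :=
  (0 < #|G|)%N && [forall u : G, forall v : G, connect edge u v].

Section Induced.
Variables (G : sgraph) (U : {set G}).

Let T : finType := Finite.clone {x : G | x \in U} _.

Fact induced_sym : symmetric (fun u v : T => edge (val u) (val v)).
Proof. by move=> u v; apply: edge_sym. Qed.

Fact induced_irr : irreflexive (fun u v : T => edge (val u) (val v)).
Proof. by move=> u; apply: edge_irr. Qed.

Definition induced : sgraph := SGraph induced_sym induced_irr.

End Induced.

(* A simple graph to which loops are added, [loops v] of them at [v]. *)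
Record loop_graph := LoopGraph {
  underlying : sgraph;
  loops : underlying -> nat }.

Definition loop_connected (H : loop_graph) : bool := connected (underlying H).

(* The subtraction is exact: degrees in G[U] are at most those in G. *)
Definition modified_induced (G : sgraph) (U : {set G}) : loop_graph :=
  @LoopGraph (induced U) (fun v =>
    degree (edges G) (val v) - degree (edges (induced U)) v)%N.

(** Matrices of a graph, the vertices being numbered by [enum_val]. *)

Definition adjacency_mx (F : nzRingType) (G : sgraph) : 'M[F]_#|G| :=
  \matrix_(i, j) (edge (enum_val i) (enum_val j))%:R.

Definition degree_mx (F : nzRingType) (G : sgraph) : 'M[F]_#|G| :=
  diag_mx (\row_i (degree (edges G) (enum_val i))%:R).

(* The principal submatrix M[U], its rows being numbered as those of the
   matrices of [induced U]. *)
Definition principal_submx (F : nzRingType) (G : sgraph) (M : 'M[F]_#|G|)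
    (U : {set G}) : 'M[F]_#|induced U| :=
  let f (i : 'I_#|induced U|) : 'I_#|G| := enum_rank (val (enum_val i)) in
  mxsub f f M.

(* e^{i t}, by Euler's formula. *)
Definition expi (R : realType) (t : R) : R[i] := cos t +i* sin t.

Definition phase_mx (R : realType) (k : nat) (G : sgraph) (l : G -> 'I_k) :
    'M[R[i]]_#|G| :=
  diag_mx (\row_i expi (2 * pi * (l (enum_val i))%:R / k%:R)).

Definition phased_adjacency_mx (R : realType) (k : nat) (G : sgraph)
    (l : G -> 'I_k) : 'M[R[i]]_#|G| :=
  phase_mx R l *m adjacency_mx _ G *m phase_mx R l.

Definition signless_laplacian_mx (F : nzRingType) (G : sgraph) (U : {set G}) :
    'M[F]_#|induced U| :=
  principal_submx (degree_mx F G) U + adjacency_mx F (induced U).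

Definition phased_signless_laplacian_mx (R : realType) (k : nat) (G : sgraph)
    (U : {set G}) (l : induced U -> 'I_k) : 'M[R[i]]_#|induced U| :=
  principal_submx (degree_mx _ G) U + phased_adjacency_mx R l.

(* [eigenvalue] is stated with row vectors, M being any square matrix: left and
   right eigenvalues are the same. *)
Definition mx_spectrum (F : fieldType) (n : nat) (M : 'M[F]_n) : set F :=
  [set a | eigenvalue M a]%classic.

(** The generalized power G^{k,k/2}: [blob v] is the set replacing [v], with
    [(v, 0)] in the role of [v] itself. *)

Definition gpower_vertex (G : sgraph) (k : nat) : finType :=
  Finite.clone (G * 'I_k./2)%type _.

Definition blob (G : sgraph) (k : nat) (v : G) : {set gpower_vertex G k} :=
  [set w | w.1 == v]%SET.

Definition gpower (G : sgraph) (k : nat) : hypergraph (gpower_vertex G k) :=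
  [set \bigcup_(v in e) blob k v | e : {set G} in edges G]%SET.

(* This is what makes k the right order for the tensors of [gpower G k]. *)
Fact gpower_uniform (G : sgraph) (k : nat) : ~~ odd k -> uniform k (gpower G k).
Proof.
move=> k_even _ /imsetP[_ /imsetP[[u v] /= uv ->] ->].
rewrite inE /= in uv.
have neq_uv : u != v by apply: contraTneq uv => ->; rewrite edge_irr.
have -> : (\bigcup_(w in [set u; v]) blob k w)%SET
    = finset.setX [set u; v]%SET [set: 'I_k./2]%SET.
  apply/setP=> -[w c]; rewrite finset.in_setX finset.in_setT andbT.
  by rewrite finset.bigcup_setU !big_set1 !inE.
by rewrite cardsX cards2 neq_uv cardsT card_ord mul2n even_halfK.
Qed.

(* Main.v *)
(** At a vertex [(v, c)] the eigenvalue equation of the pencil "diagonal [d]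
    plus adjacency tensor" of G^{k,k/2} reads, with [y v] the product of [x]
    over the blob of [v],
      (lam - d v) x_{v,c}^{k-1} = (prod_{c' <> c} x_{v,c'}) sum_{u ~ v} y u.
    Multiplied by x_{v,c}, it shows that x_{v,c}^k does not depend on [c] where
    [y v <> 0] (unless [lam = d v]), hence that (y v)^2 / x_{v,c}^k is a
    (k/2)-th root of unity, which is the square p_v^2 of a k-th root of unity.
    On the support of [y] this gives (lam - d v) y_v = p_v^2 sum_{u ~ v} y_u, so
    that y / p is an eigenvector of the phased matrix; it may be restricted to a
    connected component.  If [y] vanishes, [lam] is some [d v].  Conversely, from
    an eigenvector [z] one takes s_v^{k/2} = z_v and puts p_v s_v at one vertex
    of the blob of [v] and s_v at the others.  If [x] is real, the roots of unity
    are nonnegative, hence 1; conversely a real [z] is |z| with the signs of [z]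
    as phases. *)

Require Import Defs.
From mathcomp Require Import all_boot all_order all_algebra.
From mathcomp Require Import mathcomp_extra boolp classical_sets reals trigo.
From mathcomp Require Import complex.
From mathcomp Require Import ring lra.
Set Implicit Arguments.
Unset Strict Implicit.
Unset Printing Implicit Defensive.

Import Order.TTheory GRing.Theory Num.Theory.

Local Open Scope ring_scope.

(** * Roots of unity on the unit circle *)

Lemma expiX (R : realType) (t : R) (n : nat) : expi t ^+ n = expi (t *+ n).
Proof.
elim: n => [|n IHn]; first by rewrite /expi mulr0n cos0 sin0.
rewrite exprS IHn mulrS /expi cosD sinD; apply/eqP; rewrite eq_complex /=.
by rewrite eqxx /= addrC eqxx.
Qed.

Lemma expi2pi (R : realType) : expi (2 * pi : R) = 1.
Proof. by rewrite /expi mulr_natl cos2pi sin2pi. Qed.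

(** Half-angle argument: [cos t = 1] would force [sin (t / 2) = 0], but [t / 2] lies strictly
    between 0 and [pi]. *)
Lemma expi_neq1 (R : realType) (t : R) : 0 < t < 2 * pi -> expi t != 1.
Proof.
move=> t_bd; have sin_gt0 : 0 < sin (t / 2).
  by apply: sin_gt0_pi; case/andP: t_bd => *; apply/andP; split; lra.
apply/eqP => /(congr1 (@complex.Re R)) /= cos_t.
have def_t : t = (t / 2) *+ 2 by rewrite -mulr_natr divfK ?pnatr_eq0.
have := sin_gt0; rewrite def_t cos_mulr2n cos2sin2 in cos_t.
have /eqP : sin (t / 2) ^+ 2 *+ 2 = 0.
  by move: cos_t; rewrite mulrnBl; lra.
by rewrite mulrn_eq0 /= expf_eq0 /= => /eqP ->; rewrite ltxx.
Qed.

(** Primitivity is what lets every [n]-th root of unity be written as a power of this one. *)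
Lemma expi_prim_root (R : realType) (n : nat) : (0 < n)%N ->
  n.-primitive_root (expi (2 * pi / n%:R : R)).
Proof.
move=> n_gt0; have n_gt0R : 0 < n%:R :> R by rewrite ltr0n.
apply/andP; split=> //; apply/forallP => i; rewrite unity_rootE expiX.
case: (ltngtP i.+1 n) (ltn_ord i) => // [lt_in _|-> _]; last first.
  by rewrite -(mulr_natr (_ / _)) divfK ?pnatr_eq0 -?lt0n // expi2pi eqxx.
rewrite eqbF_neg; apply: expi_neq1; rewrite -(mulr_natr (_ / _)) mulrAC.
have i_gt0 : 0 < (i.+1)%:R / n%:R :> R by apply: divr_gt0; rewrite ?ltr0n.
have i_lt1 : (i.+1)%:R / n%:R < 1 :> R by rewrite ltr_pdivrMr // mul1r ltr_nat.
have pi2_gt0 : 0 < 2 * pi :> R by apply: mulr_gt0; rewrite ?pi_gt0.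
by rewrite -mulrA mulr_gt0 //= gtr_pMr // mulrC.
Qed.

Lemma expi_unity_root (R : realType) (k l : nat) : (0 < k)%N ->
  expi (2 * pi * l%:R / k%:R : R) ^+ k = 1.
Proof.
move=> k_gt0; rewrite expiX -(mulr_natr (_ / _)).
rewrite divfK ?pnatr_eq0 -?lt0n // mulr_natr.
by rewrite -expiX expi2pi expr1n.
Qed.

(** Write [z] as the [i]-th power of [expi (2 * pi / h)], where [h = k./2]. Since [k = 2h], halving
    the angle of [z] gives the label [l = i], which is below [h] and so below [k]. *)
Lemma half_unity_root_sqr (R : realType) (k : nat) (z : R[i]) :
  (0 < k)%N -> ~~ odd k -> z ^+ k./2 = 1 ->
  exists l : 'I_k, z = expi (2 * pi * l%:R / k%:R) ^+ 2.
Proof.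
move=> k_gt0 k_even zh1.
have def_k : k = (k./2 * 2)%N by rewrite muln2 even_halfK.
have h_gt0 : (0 < k./2)%N by move: k_gt0; rewrite {1}def_k; case: k./2.
have [i ->] := prim_rootP (expi_prim_root R h_gt0) zh1.
have lt_ik : (i < k)%N.
  by rewrite (leq_trans (ltn_ord i)) // {2}def_k leq_pmulr.
have def_kR : k%:R = (k./2)%:R * 2 :> R by rewrite {1}def_k natrM.
exists (Ordinal lt_ik); rewrite !expiX def_kR; congr expi.
rewrite -!(mulr_natr (_ / _)) /=; field.
by rewrite pnatr_eq0 -lt0n.
Qed.

(** * The action of diagonal and adjacency tensors on a vector *)

Lemma tensor_app_cons (R : realType) (m : nat) (I : finType)
    (T : tensor R m.+1 I) (x : {ffun I -> R[i]}) (i : I) :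
  tensor_app T x i =
  \sum_(t : m.-tuple I) (T [tuple of i :: t])%:C%C * \prod_(j <- t) x j.
Proof.
rewrite ffunE (reindex_onto (fun t : m.-tuple I => [tuple of i :: t])
  (fun t => [tuple of behead t])) /=.
  by apply: eq_bigl => t; rewrite eqxx; apply/eqP/val_inj.
move=> t; case/tupleP: t => j t /= /eqP[->].
by congr [tuple of _ :: _]; apply/val_inj.
Qed.

Lemma tensor_appD (R : realType) (k : nat) (I : finType)
    (T S : tensor R k I) (x : {ffun I -> R[i]}) (i : I) :
  tensor_app (T + S) x i = tensor_app T x i + tensor_app S x i.
Proof.
rewrite !ffunE -big_split; apply: eq_bigr => t _ /=.
by rewrite ffunE rmorphD mulrDl.
Qed.

Lemma tensor_app_diag (R : realType) (k : nat) (I : finType) (d : I -> R)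
    (x : {ffun I -> R[i]}) (i : I) : (0 < k)%N ->
  tensor_app (diag_tensor k d) x i = (d i)%:C%C * x i ^+ k.-1.
Proof.
case: k => // m _.
rewrite tensor_app_cons (bigD1 [tuple of nseq m i]) //=.
rewrite [X in _ + X]big1 ?addr0 => [|t].
  rewrite ffunE /= eqxx all_nseq /= eqxx orbT mulr1n.
  by rewrite big_nseq -Monoid.iteropE.
move=> nt; rewrite ffunE /= eqxx /=; case: allP => [t_i|]; last by rewrite mul0r.
case/eqP: nt; apply/val_inj => /=; rewrite -[in RHS](size_tuple t).
by apply/all_pred1P/allP.
Qed.

(** Group the multi-indices starting at [v] by the edge [e] that they span. Their tails are the
    [(k-1)!] orderings of [e :\ v], all with the same monomial, and this number cancels the entry
    [1/(k-1)!] of the tensor. *)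
Lemma tensor_app_adjacency (R : realType) (k : nat) (V : finType)
    (H : hypergraph V) (x : {ffun V -> R[i]}) (v : V) :
  (0 < k)%N -> uniform k H ->
  tensor_app (adjacency_tensor R k H) x v =
  \sum_(e in H | v \in e) \prod_(w in e | w != v) x w.
Proof.
case: k => // m _ unifH; rewrite tensor_app_cons.
transitivity (\sum_(t : m.-tuple V | v |: [set w in t] \in H)
    (m`!%:R^-1)%:C%C * \prod_(j <- t) x j).
  rewrite [RHS]big_mkcond; apply: eq_bigr => t _; rewrite ffunE /=.
  rewrite finset.set_cons; case: ifP => _ //; by rewrite mul0r.
rewrite (partition_big (fun t : m.-tuple V => v |: [set w in t])
  (fun e => (e \in H) && (v \in e))) /=; last first.
  by move=> t ->; rewrite setU11.
apply: eq_bigr => e /andP[eH ve]; have card_e := unifH _ eH.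
have card_ev : #|e :\ v| = m by move: card_e; rewrite (cardsD1 v) ve; case.
(* By uniformity the [m] entries of [t] must cover the [m] vertices of [e :\ v]; there is room
   neither for a repetition nor for [v] itself. *)
have entries (t : m.-tuple V) :
    (v |: [set w in t] \in H) && (v |: [set w in t] == e) =
    all [in e :\ v] t && uniq t.
  apply/andP/andP => [[_ /eqP def_e]|[/allP t_e t_uniq]].
    have sub_et : e :\ v \subset [set w in t].
      by rewrite -def_e; apply/fintype.subsetP => w; rewrite !inE; case: eqP.
    have card_t : (#|[set w in t]| <= m)%N.
      by rewrite cardsE (leq_trans (card_size _)) ?size_tuple.
    have eq_et : e :\ v = [set w in t].
      by apply/eqP; rewrite eqEcard sub_et card_ev.
    split; first by apply/allP => w wt; rewrite eq_et inE.
    by apply/card_uniqP; rewrite size_tuple -cardsE -eq_et.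
  suff -> : v |: [set w in t] = e by [].
  have -> : [set w in t] = e :\ v; last by rewrite finset.setD1K.
  apply/eqP; rewrite eqEcard card_ev cardsE (card_uniqP t_uniq) size_tuple leqnn.
  by rewrite andbT; apply/fintype.subsetP => w; rewrite inE => /t_e.
rewrite (eq_bigl _ _ entries) (eq_bigr (fun=> (m`!%:R^-1)%:C%C *
  \prod_(w in e | w != v) x w)) => [|t]; last first.
  case/andP => /allP t_e t_uniq; congr (_ * _).
  rewrite big_uniq //=; apply: eq_bigl => w.
  suff /setP/(_ w) : [set w in t] = e :\ v by rewrite !inE andbC.
  apply/eqP; rewrite eqEcard card_ev cardsE (card_uniqP t_uniq) size_tuple leqnn.
  by rewrite andbT; apply/fintype.subsetP => u; rewrite inE => /t_e.
rewrite sumr_const.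
have -> : #|[pred t : m.-tuple V | all [in e :\ v] t && uniq t]| = m`!.
  have := card_uniq_tuples m [in e :\ v]; rewrite card_ev ffactnn => <-.
  by rewrite cardsE.
rewrite fmorphV /= rmorph_nat -mulrnAl -mulr_natl mulfV ?mul1r //.
by rewrite pnatr_eq0 -lt0n fact_gt0.
Qed.

(** * Edges and degrees of the generalized power *)

Lemma mem_bigcup_blob (G : sgraph) (k : nat) (e : {set G})
    (w : gpower_vertex G k) :
  (w \in \bigcup_(v in e) blob k v) = (w.1 \in e).
Proof.
apply/bigcupP/idP => [[v ve]|we]; first by rewrite inE => /eqP ->.
by exists w.1; rewrite ?inE.
Qed.

(** Blobs are nonempty, so [v] can be tested through its copy [(v, 0)]. *)
Lemma bigcup_blob_inj (G : sgraph) (k : nat) : (0 < k./2)%N ->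
  injective (fun e : {set G} => \bigcup_(v in e) blob k v).
Proof.
move=> h_gt0 e f /setP eq_ef; apply/setP => v.
by have := eq_ef (v, Ordinal h_gt0); rewrite !mem_bigcup_blob.
Qed.

(** With the injectivity of [u |-> [set v; u]] on neighbours, this turns sums over the edges at [v]
    into sums over its neighbours. *)
Lemma incident_edges (G : sgraph) (v : G) :
  [set e in edges G | v \in e] = [set [set v; u] | u in edge v].
Proof.
apply/setP => e; rewrite inE; apply/andP/imsetP => [[]|[u vu ->]].
  move=> /imsetP[[a b]]; rewrite inE /= => ab -> /set2P[]->; first by exists b.
  exists a; last by rewrite finset.setUC.
  by rewrite -[_ \in _]/(edge b a) edge_sym.
by rewrite set21; split=> //; apply/imsetP; exists (v, u); rewrite ?inE.
Qed.

Lemma set2_inj (T : finType) (v : T) :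
  {in [pred u | u != v] &, injective (fun u => [set v; u])}.
Proof.
move=> a b; rewrite !inE => av bv /setP/(_ a).
by rewrite !inE eqxx orbT (negPf av) => /esym/eqP.
Qed.

Lemma edge_neq (G : sgraph) (v u : G) : edge v u -> u != v.
Proof. by apply: contraTneq => ->; rewrite edge_irr. Qed.

Lemma edge_set2_inj (G : sgraph) (v : G) :
  {in edge v &, injective (fun u => [set v; u])}.
Proof.
by move=> a b va vb; apply: set2_inj; rewrite inE; apply: edge_neq.
Qed.

Lemma incident_gpower (G : sgraph) (k : nat) (w : gpower_vertex G k) :
  [set e in gpower G k | w \in e] =
  [set \bigcup_(v in e) blob k v
    | e : {set G} in [set e in edges G | w.1 \in e]].
Proof.
apply/setP => e; rewrite inE; apply/andP/imsetP => [[/imsetP[f fG ->]]|[f]].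
  by rewrite mem_bigcup_blob => wf; exists f; rewrite // inE fG.
rewrite inE => /andP[fG wf] ->; rewrite mem_bigcup_blob wf.
by split=> //; apply/imsetP; exists f.
Qed.

Lemma degree_gpower (G : sgraph) (k : nat) (w : gpower_vertex G k) :
  (0 < k./2)%N -> degree (gpower G k) w = degree (edges G) w.1.
Proof.
move=> h_gt0; rewrite /degree incident_gpower card_imset //.
exact: bigcup_blob_inj.
Qed.

Lemma prod_blob (C : comNzRingType) (G : sgraph) (k : nat) (v : G)
    (Q : pred 'I_k./2) (x : gpower_vertex G k -> C) :
  \prod_(w | (w.1 == v) && Q w.2) x w = \prod_(c | Q c) x (v, c).
Proof.
rewrite (reindex_onto (pair v) snd) /=; last by case=> a b /= /andP[/eqP ->].
by apply: eq_bigl => c; rewrite !eqxx andbT.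
Qed.

(** An edge at [(v, c)] is the blob of [v] together with that of a neighbour [u]. Removing [(v, c)]
    leaves the rest of the first blob, a factor common to all edges, and the whole second blob. *)
Lemma tensor_app_adjacency_gpower (R : realType) (G : sgraph) (k : nat)
    (x : {ffun gpower_vertex G k -> R[i]}) (v : G) (c : 'I_k./2) :
  (0 < k./2)%N -> ~~ odd k ->
  tensor_app (adjacency_tensor R k (gpower G k)) x (v, c) =
  (\prod_(c' | c' != c) x (v, c')) * \sum_(u | edge v u) \prod_c' x (u, c').
Proof.
move=> h_gt0 k_even; rewrite tensor_app_adjacency; first last.
- exact: gpower_uniform.
- by case: k h_gt0 {x c k_even}.
transitivity (\sum_(e in [set e in gpower G k | (v, c) \in e])
    \prod_(w in e | w != (v, c)) x w).
  by apply: eq_bigl => e; rewrite inE.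
rewrite incident_gpower big_imset /=; last first.
  by move=> ? ? _ _; apply: bigcup_blob_inj.
rewrite incident_edges big_imset /=; last exact: edge_set2_inj.
rewrite mulr_sumr; apply: eq_bigr => u vu.
rewrite (bigID (fun w : gpower_vertex G k => w.1 == v)) /=; congr (_ * _).
  rewrite -(prod_blob _ (fun c' => c' != c)); apply: eq_bigl => -[a b].
  rewrite mem_bigcup_blob !inE /= xpair_eqE.
  by case: eqP => //=; rewrite ?andbT ?andbF.
rewrite -(prod_blob _ predT); apply: eq_bigl => -[a b].
rewrite mem_bigcup_blob !inE /= xpair_eqE andbT.
case: (eqVneq a v) => [->|_] /=; last by rewrite !andbT.
by rewrite andbF eq_sym (negPf (edge_neq (vu : edge v u))).
Qed.

(** The diagonal [d] is kept arbitrary so that one argument serves both tensors: zero gives the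
    adjacency tensor, the degrees give the signless Laplacian. *)
Lemma gpower_eigenpairE (R : realType) (G : sgraph) (k : nat) (d : G -> R)
    (lam : R[i]) (x : {ffun gpower_vertex G k -> R[i]}) :
  (0 < k./2)%N -> ~~ odd k ->
  tensor_eigenpair (diag_tensor k (fun w => d w.1)
    + adjacency_tensor R k (gpower G k)) lam x <->
  x != 0 /\ forall v c, (lam - (d v)%:C%C) * x (v, c) ^+ k.-1 =
    (\prod_(c' | c' != c) x (v, c')) * \sum_(u | edge v u) \prod_c' x (u, c').
Proof.
move=> h_gt0 k_even; have k_gt0 : (0 < k)%N by case: k h_gt0 {x k_even}.
split=> -[x_neq0 eq_x]; split=> //.
  move=> v c; move: (eq_x (v, c)).
  rewrite tensor_appD tensor_app_diag // tensor_app_adjacency_gpower //= mulrBl.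
  by move=> <-; rewrite addrC addKr.
case=> v c; rewrite tensor_appD tensor_app_diag // tensor_app_adjacency_gpower //.
by rewrite -eq_x mulrBl addrC subrK.
Qed.

Lemma diag_tensor0 (R : realType) (k : nat) (I : finType) :
  diag_tensor k (fun=> 0) = 0 :> tensor R k I.
Proof.
by apply/ffunP => t; rewrite !ffunE; case: ohead => // ?; rewrite mul0rn.
Qed.

(** * Phased eigenvectors and restriction to a connected component *)

(** An eigenvector of [D[U] + E A(G[U]) E], extended by zero to all of [G]: neighbour sums can then
    run over the whole graph, and changing [U] does not change the type of [z]. *)
Definition phased_eigvec (C : numClosedFieldType) (G : sgraph) (d e : G -> C)
    (lam : C) (U : {set G}) (z : G -> C) : Prop :=
  [/\ exists v, z v != 0, forall v, v \notin U -> z v = 0 &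
      forall v, v \in U ->
        (lam - d v) * z v = e v * \sum_(u | edge v u) e u * z u].

(** [W] is the component of [v] for the edges having both ends in [U]. *)
Lemma connected_component (G : sgraph) (U : {set G}) (v : G) : v \in U ->
  exists W : {set G}, [/\ v \in W, W \subset U, connected (induced W) &
    forall a b, a \in W -> b \in U -> edge a b -> b \in W].
Proof.
move=> vU; pose e := [rel a b : G | [&& edge a b, a \in U & b \in U]].
have e_sym : connect_sym e.
  apply: sym_connect_sym => a b /=.
  by rewrite edge_sym [(a \in U) && _]andbC.
have sub_U a : connect e v a -> a \in U.
  case/connectP => p; elim/last_ind: p => [|p w _] /=; first by move=> _ ->.
  by rewrite rcons_path last_rcons => /andP[_ /and3P[_ _ ?]] ->.
exists [set u | connect e v u]; split.
- by rewrite inE.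
- by apply/fintype.subsetP => u; rewrite inE; apply: sub_U.
- set W := [set u | _].
  (* A path of [e] that starts in [W] never leaves it, so it is also a path of the induced
     subgraph. *)
  have lift p a (aW : a \in W) : path e a p -> forall bW : last a p \in W,
      connect edge (Sub a aW : induced W) (Sub (last a p) bW).
    elim: p a aW => [|b p IHp] a aW /=.
      by move=> _ bW; rewrite (bool_irrelevance bW aW).
    case/andP=> e_ab e_p cW; have bW : b \in W.
      by move: aW; rewrite !inE => /connect_trans; apply; apply: connect1.
    apply: connect_trans (IHp b bW e_p cW).
    by apply: connect1; case/and3P: e_ab.
  apply/andP; split.
    have vW : v \in W by rewrite inE.
    by apply/card_gt0P; exists (Sub v vW : induced W).
  apply/forallP => -[a aW]; apply/forallP => -[b bW].
  have /connectP[p e_p def_b] : connect e a b.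
    by move: (aW) (bW); rewrite !inE e_sym; apply: connect_trans.
  subst b; exact: (lift p a aW e_p bW).
- move=> a b; rewrite !inE => va bU ab; apply: connect_trans (va) _.
  by apply: connect1; rewrite /= ab bU sub_U.
Qed.

(** Cut [z] down to the component of a vertex where it is nonzero. A neighbour lost at a vertex of
    [W] lies outside [U], where [z] vanishes already, so the neighbour sums at [W] are unchanged. *)
Lemma phased_eigvec_connected (C : numClosedFieldType) (G : sgraph)
    (d e : G -> C) (lam : C) (U : {set G}) (z : G -> C) :
  phased_eigvec d e lam U z ->
  exists W : {set G}, connected (induced W) /\
    exists z', phased_eigvec d e lam W z'.
Proof.
case=> -[v z_v] z_out z_in.
have vU : v \in U by apply: contraR z_v => /z_out ->.
have [W [vW sub_WU W_conn W_closed]] := connected_component vU.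
exists W; split=> //; exists (fun u => z u *+ (u \in W)); split.
- by exists v; rewrite vW.
- by move=> u /negPf ->.
move=> u uW; rewrite uW z_in ?(fintype.subsetP sub_WU) //; congr (_ * _).
apply: eq_bigr => w uw; congr (_ * _).
case: (boolP (w \in W)) => // wW; rewrite z_out //.
by apply: contraNN wW => wU; apply: W_closed uw.
Qed.

(** * Passing between vectors on the blobs and phased vectors on the graph *)

(** The local computation in one blob, with [a] for [lam - d v] and [S] for the neighbour sum. All
    [x c ^+ (h * 2)] equal [r = y * S / a]; their product gives [r ^+ h = y ^+ (h * 2)], so
    [t = y ^+ 2 / r] is an [h]-th root of unity. For real [x] it is a quotient of even powers, and 1
    is the only nonnegative root of unity. *)
Lemma blob_phase (C : numClosedFieldType) (h : nat) (a S : C) (x : 'I_h -> C) :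
  (0 < h)%N -> \prod_c x c != 0 ->
  (forall c, a * x c ^+ (h * 2).-1 = (\prod_(c' | c' != c) x c') * S) ->
  exists t : C, [/\ t ^+ h = 1, a * \prod_c x c = t * S &
    (forall c, x c \is Num.real) -> t = 1].
Proof.
move=> h_gt0; set y := \prod_c x c => y_neq0 eq_x.
have eq_xk c : a * x c ^+ (h * 2) = y * S.
  rewrite -(prednK (_ : 0 < h * 2)%N) ?muln_gt0 ?h_gt0 // exprSr mulrA eq_x.
  by rewrite mulrAC /y [\prod_c' _](bigD1 c) //= [x c * _]mulrC.
have [a0|a_neq0] := eqVneq a 0.
  (* When [a = 0] the equation forces [S = 0], as [y] is nonzero, and any root of unity would do. *)
  exists 1; split; rewrite ?expr1n // a0 mul0r mul1r.
  have /eqP := eq_xk (Ordinal h_gt0).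
  by rewrite a0 mul0r eq_sym mulf_eq0 (negPf y_neq0) => /eqP.
pose r := y * S / a.
have def_r c : x c ^+ (h * 2) = r by rewrite /r -(eq_xk c) mulrAC mulfV ?mul1r.
have rh : r ^+ h = y ^+ (h * 2).
  rewrite /y -prodrXl (eq_bigr _ (fun c _ => def_r c)).
  by rewrite prodr_const card_ord.
have r_neq0 : r != 0.
  by have := expf_neq0 (h * 2) y_neq0; rewrite -rh expf_eq0 h_gt0.
have S_neq0 : S != 0.
  by apply: contraNneq r_neq0 => S0; rewrite /r S0 mulr0 mul0r.
have th : (y ^+ 2 / r) ^+ h = 1.
  by rewrite expr_div_n rh -exprM mulnC mulfV // expf_neq0.
exists (y ^+ 2 / r); split=> // [|x_real].
  by rewrite /r; field; rewrite S_neq0 y_neq0 a_neq0.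
apply/eqP; rewrite -(pexpr_eq1 h_gt0) ?th //.
have y_real : y \is Num.real by apply: rpred_prod.
apply: divr_ge0; first by rewrite real_exprn_even_ge0.
by rewrite -(def_r (Ordinal h_gt0)) real_exprn_even_ge0 ?oddM ?andbF.
Qed.

Lemma blob_eigvec_phases (C : numClosedFieldType) (G : sgraph) (h : nat)
    (d : G -> C) (lam : C) (x : G * 'I_h -> C) :
  (0 < h)%N -> (exists w, x w != 0) ->
  (forall v c, (lam - d v) * x (v, c) ^+ (h * 2).-1 =
    (\prod_(c' | c' != c) x (v, c')) *
    \sum_(u | edge v u) \prod_c' x (u, c')) ->
  exists (U : {set G}) (t y : G -> C),
  [/\ forall v, t v ^+ h = 1, (forall w, x w \is Num.real) -> forall v, t v = 1,
      exists v, y v != 0, forall v, v \notin U -> y v = 0 &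
      forall v, v \in U -> (lam - d v) * y v = t v * \sum_(u | edge v u) y u].
Proof.
move=> h_gt0 [[v0 c0] x_neq0] eq_x; pose y v := \prod_c x (v, c).
have [y0|] := boolP [forall v, y v == 0]; last first.
  rewrite negb_forall => /existsP[v1 y_v1].
  have phase v : exists t : C, [/\ t ^+ h = 1,
      y v != 0 -> (lam - d v) * y v = t * \sum_(u | edge v u) y u &
      (forall w, x w \is Num.real) -> t = 1].
    (* Off the support of [y] nothing constrains the phase; 1 is a default compatible with the real
       case. *)
    have [_|y_v] := eqVneq (y v) 0; first by exists 1; rewrite expr1n.
    have [t [? ? t1]] := blob_phase h_gt0 y_v (eq_x v).
    by exists t; split=> // x_real; apply: t1.
  have [t tP] := fin_all_exists phase.
  exists [set v | y v != 0], t, y; split.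
  - by move=> v; case: (tP v).
  - by move=> x_real v; case: (tP v) => _ _; apply.
  - by exists v1.
  - by move=> v; rewrite inE negbK => /eqP.
  - by move=> v; rewrite inE; case: (tP v).
(* Here every blob product vanishes, so the equation at [(v0, c0)] gives [lam = d v0]. The indicator
   of [v0] is an eigenvector on the single vertex, whose neighbour sum is zero for want of loops. *)
exists [set v0], (fun=> 1), (fun v => (v == v0)%:R); split=> //.
- by move=> v; rewrite expr1n.
- by exists v0; rewrite eqxx oner_eq0.
- by move=> v; rewrite inE => /negPf ->.
move=> v; rewrite inE => /eqP ->; rewrite eqxx mulr1 mul1r big1 => [|u]; last first.
  by move/edge_neq/negPf ->.
have /eqP := eq_x v0 c0; rewrite [X in _ == _ * X]big1 => [|u _]; last first.
  by move/forallP/(_ u)/eqP: y0.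
by rewrite mulr0 mulf_eq0 expf_eq0 (negPf x_neq0) andbF orbF => /eqP.
Qed.

(** The blob of [v] has product [e v * s v ^+ h], while the phase disappears from
    [x (v, c) ^+ (h * 2)]. Where [s v] is nonzero, the tensor equation multiplied by [x (v, c)] is
    therefore the assumed equation multiplied by [s v ^+ h]. *)
Lemma phases_blob_eigvec (C : numClosedFieldType) (G : sgraph) (h : nat)
    (d e s : G -> C) (lam : C) (x : G * 'I_h -> C) :
  (1 < h)%N -> (forall v, e v ^+ (h * 2) = 1) ->
  (forall v c, x (v, c) = if c == 0 :> nat then e v * s v else s v) ->
  (forall v, s v != 0 ->
    (lam - d v) * s v ^+ h = e v * \sum_(u | edge v u) e u * s u ^+ h) ->
  forall v c, (lam - d v) * x (v, c) ^+ (h * 2).-1 =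
    (\prod_(c' | c' != c) x (v, c')) * \sum_(u | edge v u) \prod_c' x (u, c').
Proof.
move=> h_gt1 e_root def_x eq_s v c; have h_gt0 : (0 < h)%N by apply: ltnW.
have def_y u : \prod_c' x (u, c') = e u * s u ^+ h.
  rewrite (bigD1 (Ordinal h_gt0)) //= def_x /= (eq_bigr (fun=> s u)) => [|c' c'0].
    by rewrite prodr_const cardC1 card_ord -mulrA -exprS prednK.
  by rewrite def_x ifN.
have x_root : x (v, c) ^+ (h * 2) = s v ^+ (h * 2).
  by rewrite def_x; case: ifP => // _; rewrite exprMn e_root mul1r.
rewrite (eq_bigr _ (fun u _ => def_y u)).
have [s0|s_neq0] := eqVneq (s v) 0.
  have x0 c' : x (v, c') = 0 by rewrite def_x s0 mulr0 if_same.
  (* The product over [c' != c] vanishes only if the blob has a second vertex: this is where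
     [1 < h], that is [k >= 4], is needed. *)
  have [c' c'_neq] : exists c' : 'I_h, c' != c.
    case: (eqVneq c (Ordinal h_gt0)) => [->|nc]; first by exists (Ordinal h_gt1).
    by exists (Ordinal h_gt0); rewrite eq_sym.
  rewrite x0 (bigD1 c') //= x0 !mul0r expr0n.
  by rewrite -subn1 subn_eq0 leqNgt (leq_trans h_gt1) ?leq_pmulr //= mulr0.
have x_neq0 : x (v, c) != 0.
  by have := expf_neq0 (h * 2) s_neq0; rewrite -x_root expf_eq0 muln_gt0 h_gt0.
apply: (mulIf x_neq0); rewrite -mulrA -exprSr prednK ?muln_gt0 ?h_gt0 // x_root.
rewrite mulrAC -[_ * x (v, c)]mulrC -(bigD1 c (P := predT)) //= def_y.
by rewrite mulrAC -eq_s // exprM expr2 !mulrA.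
Qed.

(** * Eigenvalues of the matrices, and real eigenvectors *)

Lemma mx_spectrum_enumP (F : fieldType) (T : finType) (M : 'M[F]_#|T|) (a : F) :
  mx_spectrum M a <-> exists2 z : T -> F, exists v, z v != 0 &
    forall v, \sum_u z u * M (enum_rank u) (enum_rank v) = a * z v.
Proof.
split=> [/eigenvalueP[r rM r_neq0]|[z [v z_v] zM]].
  exists (fun v => r 0 (enum_rank v)).
    apply/existsP; apply: contraR r_neq0; rewrite negb_exists => /forallP r0.
    apply/eqP/rowP => i; rewrite mxE; apply/eqP.
    by have := r0 (enum_val i); rewrite enum_valK negbK.
  move=> v; move/rowP/(_ (enum_rank v)): rM; rewrite !mxE => <-.
  rewrite [RHS](reindex enum_rank) //.
  by apply: onW_bij; exists enum_val; [apply: enum_rankK | apply: enum_valK].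
apply/eigenvalueP; exists (\row_i z (enum_val i)).
  apply/rowP => i; rewrite !mxE -zM enum_valK [LHS](reindex enum_rank).
    by apply: eq_bigr => u _; rewrite mxE enum_rankK.
  by apply: onW_bij; exists enum_val; [apply: enum_rankK | apply: enum_valK].
apply: contraNneq z_v => /rowP/(_ (enum_rank v)).
by rewrite !mxE enum_rankK => ->.
Qed.

Lemma sum_induced_neighbours (C : nmodType) (G : sgraph) (U : {set G})
    (f : G -> C) (v : induced U) : (forall u, u \notin U -> f u = 0) ->
  \sum_(u : induced U | edge (val v) (val u)) f (val u) =
  \sum_(u | edge (val v) u) f u.
Proof.
move=> f_out; rewrite (bigID [in U]) /= [X in _ = _ + X]big1 ?addr0 => [|u].
  rewrite (eq_bigl (fun u => (u \in U) && edge (val v) u)) ?big_sub_cond // => u.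
  by rewrite andbC.
by case/andP => _; apply: f_out.
Qed.

(** The prescribed entries make [M] symmetric, so its row eigenvectors satisfy the column equation;
    one passes between [U] and [G] by extending by zero and restricting. *)
Lemma mx_spectrum_phasedP (C : numClosedFieldType) (G : sgraph) (U : {set G})
    (d e : G -> C) (M : 'M[C]_#|induced U|) (lam : C) :
  (forall u v : induced U, M (enum_rank u) (enum_rank v) =
    d (val u) *+ (u == v) + e (val u) * (edge (val u) (val v))%:R * e (val v)) ->
  mx_spectrum M lam <-> exists z, phased_eigvec d e lam U z.
Proof.
move=> def_M.
have sumE (z : induced U -> C) (v : induced U) :
    \sum_u z u * M (enum_rank u) (enum_rank v) =
    d (val v) * z v +
    e (val v) * \sum_(u | edge (val v) (val u)) e (val u) * z u.
  under eq_bigr do rewrite def_M mulrDr.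
  rewrite big_split /=; congr (_ + _).
    rewrite (bigD1 v) //= eqxx mulr1n mulrC big1 ?addr0 // => u /negPf ->.
    by rewrite mulr0n mulr0.
  rewrite mulr_sumr [RHS]big_mkcond; apply: eq_bigr => u _.
  rewrite [edge (val u) _]edge_sym; case: ifP => _; last first.
    by rewrite mulr0 mul0r mulr0.
  by rewrite mulr1 mulrC [e _ * e _]mulrC mulrA.
rewrite mx_spectrum_enumP; split=> [[z [v z_v] zM]|[z [[v z_v] z_out z_in]]].
  pose z' v := if insub v is Some u then z (u : induced U) else 0.
  have z'E (u : induced U) : z' (val u) = z u by rewrite /z' valK.
  exists z'; split; first by exists (val v); rewrite z'E.
    by move=> u uU; rewrite /z' insubN.
  move=> u uU; pose u' : induced U := Sub u uU.
  rewrite -[u]/(val u') z'E mulrBl -zM sumE addrC addKr; congr (_ * _).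
  rewrite -sum_induced_neighbours => [|w wU]; last by rewrite /z' insubN ?mulr0.
  by apply: eq_bigr => w _; rewrite z'E.
exists (fun u => z (val u)).
  have vU : v \in U by apply: contraR z_v => /z_out ->.
  by exists (Sub v vU).
move=> v'; rewrite sumE (sum_induced_neighbours v' (f := fun u => e u * z u)).
  by rewrite -z_in ?(valP v') // mulrBl addrC subrK.
by move=> u /z_out ->; rewrite mulr0.
Qed.

Lemma phased_adjacency_mxE (R : realType) (k : nat) (G : sgraph)
    (l : G -> 'I_k) (u v : G) :
  phased_adjacency_mx R l (enum_rank u) (enum_rank v) =
  expi (2 * pi * (l u)%:R / k%:R) * (edge u v)%:R *
  expi (2 * pi * (l v)%:R / k%:R).
Proof.
by rewrite /phased_adjacency_mx mul_mx_diag mul_diag_mx !mxE !enum_rankK.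
Qed.

Lemma principal_degree_mxE (F : nzRingType) (G : sgraph) (U : {set G})
    (u v : induced U) :
  principal_submx (degree_mx F G) U (enum_rank u) (enum_rank v) =
  (degree (edges G) (val u))%:R *+ (u == v).
Proof.
by rewrite !mxE !enum_rankK (inj_eq enum_rank_inj) (inj_eq val_inj).
Qed.

Lemma adjacency_mxE (F : nzRingType) (G : sgraph) (u v : G) :
  adjacency_mx F G (enum_rank u) (enum_rank v) = (edge u v)%:R.
Proof. by rewrite mxE !enum_rankK. Qed.

(* The form z^* A z is real, hence so is [lam], and the real and imaginary parts
   of [z] satisfy the eigenvalue equation. *)
Lemma real_eigvec (C : numClosedFieldType) (G : sgraph) (d : G -> C) (lam : C)
    (U : {set G}) (z : G -> C) :
  (forall v, d v \is Num.real) -> phased_eigvec d (fun=> 1) lam U z ->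
  exists2 z', phased_eigvec d (fun=> 1) lam U z' &
    forall v, z' v \is Num.real.
Proof.
move=> d_real [[v0 z_v0] z_out z_in].
have eq_z v : v \in U -> (lam - d v) * z v = \sum_(u | edge v u) z u.
  by move=> vU; rewrite z_in // mul1r; apply: eq_bigr => u _; rewrite mul1r.
pose form (x y : G -> C) := \sum_v x v * \sum_(u | edge v u) y u.
have form_sym x y : form x y = form y x.
  rewrite /form; under eq_bigr do rewrite mulr_sumr.
  rewrite (exchange_big_dep predT) //=; apply: eq_bigr => u _.
  by rewrite mulr_sumr; apply: eq_big => v; rewrite ?[edge v u]edge_sym // mulrC.
have form_real : form (fun v => (z v)^* ) z \is Num.real.
  apply/CrealP; rewrite [RHS]form_sym /form rmorph_sum; apply: eq_bigr => v _.
  by rewrite rmorphM /= conjCK rmorph_sum.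
have formE : form (fun v => (z v)^* ) z = \sum_v (lam - d v) * `|z v| ^+ 2.
  apply: eq_bigr => v _; case: (boolP (v \in U)) => [vU|/z_out ->].
    by rewrite -eq_z // normCK; ring.
  by rewrite rmorph0 mul0r normr0 expr0n mulr0.
have norm_gt0 : 0 < \sum_v `|z v| ^+ 2.
  rewrite (bigD1 v0) //= ltr_pwDl ?exprn_gt0 ?normr_gt0 // sumr_ge0 // => v _.
  by rewrite exprn_ge0.
have lam_real : lam \is Num.real.
  have -> : lam = (form (fun v => (z v)^* ) z + \sum_v d v * `|z v| ^+ 2) /
      \sum_v `|z v| ^+ 2.
    rewrite formE -big_split /=; under eq_bigr do rewrite -mulrDl subrK.
    by rewrite -mulr_sumr mulfK // gt_eqF.
  rewrite rpred_div ?rpredD ?(ger0_real (ltW norm_gt0)) //.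
  by apply: rpred_sum => v _; rewrite rpredM // ger0_real ?exprn_ge0.
(* [p] stands for the real or the imaginary part. It commutes with multiplication by the real number
   [lam - d v], and at least one of the two parts is nonzero at [v0]. *)
have part (p : C -> C) : {morph p : a b / a + b} -> p 0 = 0 ->
    {in Num.real, forall a, {morph p : b / a * b}} ->
    (forall a, p a \is Num.real) -> p (z v0) != 0 ->
    exists2 z', phased_eigvec d (fun=> 1) lam U z' &
      forall v, z' v \is Num.real.
  move=> pD p0 pM p_real p_v0; exists (p \o z) => [|v]; last exact: p_real.
  split; first by exists v0.
    by move=> v /z_out /= ->.
  move=> v vU /=; rewrite -pM ?rpredB // eq_z // (big_morph p pD p0) mul1r.
  by apply: eq_bigr => u _; rewrite mul1r.
have [re0|] := eqVneq ('Re (z v0)) 0; last first.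
  by apply: (part (fun a => 'Re a));
    [apply: raddfD | apply: raddf0 | apply: ReMl | apply: Creal_Re].
apply: (part (fun a => 'Im a));
  [exact: raddfD | exact: raddf0 | exact: ImMl | exact: Creal_Im |].
by apply: contra_neq z_v0 => im0; rewrite [z v0]Crect re0 im0 mulr0 addr0.
Qed.

(** * Spectrum and H-spectrum of the generalized power, for any diagonal *)

Lemma ffun_neq0 (I : finType) (V : zmodType) (x : {ffun I -> V}) :
  x != 0 -> exists i, x i != 0.
Proof.
move=> x_neq0; apply/existsP; apply: contraR x_neq0; rewrite negb_exists.
move/forallP => x0; apply/eqP/ffunP => i; rewrite ffunE.
by apply/eqP; rewrite -[_ == _]negbK.
Qed.

Lemma gpower_spectrumP (R : realType) (k : nat) (G : sgraph) (d : G -> R)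
    (lam : R[i]) : (4 <= k)%N -> ~~ odd k ->
  spectrum (diag_tensor k (fun w : gpower_vertex G k => d w.1)
    + adjacency_tensor R k (gpower G k)) lam <->
  exists U : {set G}, connected (induced U) /\
    exists (l : G -> 'I_k) z,
      phased_eigvec (fun v => (d v)%:C%C)
        (fun v => expi (2 * pi * (l v)%:R / k%:R)) lam U z.
Proof.
move=> k_ge4 k_even; have h_gt1 : (1 < k./2)%N by apply: (half_leq k_ge4).
have h_gt0 := ltnW h_gt1; have k_gt0 : (0 < k)%N by apply: leq_trans k_ge4.
have def_k : k = (k./2 * 2)%N by rewrite muln2 even_halfK.
have def_k1 : k.-1 = (k./2 * 2).-1 by rewrite -def_k.
split=> [[x /gpower_eigenpairE[] // x_neq0 eq_x]|].
  have [w x_w] := ffun_neq0 x_neq0.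
  rewrite def_k1 in eq_x.
  have [U [t [y [t_root _ y_neq0 y_out y_in]]]] :=
    blob_eigvec_phases h_gt0 (ex_intro _ w x_w) eq_x.
  have [l lE] :=
    fin_all_exists (fun v => half_unity_root_sqr k_gt0 k_even (t_root v)).
  pose p v : R[i] := expi (2 * pi * (l v)%:R / k%:R).
  have p_neq0 v : p v != 0.
    have : p v ^+ k != 0 by rewrite expi_unity_root ?oner_eq0.
    by rewrite expf_eq0 k_gt0.
  (* As [t v = p v ^+ 2], dividing [y] by [p] splits the one-sided factor [t] evenly between the two
     sides of the adjacency matrix. *)
  have : phased_eigvec (fun v => (d v)%:C%C) p lam U (fun v => (p v)^-1 * y v).
    split.
    - by have [v y_v] := y_neq0; exists v; rewrite mulf_neq0 ?invr_eq0.
    - by move=> v /y_out ->; rewrite mulr0.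
    move=> v vU; rewrite mulrCA y_in // lE -/(p v) expr2 mulrA mulKf //.
    by congr (_ * _); apply: eq_bigr => u _; rewrite mulVKf.
  case/phased_eigvec_connected => W [W_conn [z' z'P]].
  by exists W; split=> //; exists l, z'.
case=> U [_ [l [z [[v0 z_v0] z_out z_in]]]].
pose p v : R[i] := expi (2 * pi * (l v)%:R / k%:R).
pose s v := (k./2).-root (z v).
have sK v : s v ^+ k./2 = z v by rewrite rootCK.
pose x : {ffun gpower_vertex G k -> R[i]} :=
  [ffun w : G * 'I_k./2 => if w.2 == 0 :> nat then p w.1 * s w.1 else s w.1].
exists x; apply/gpower_eigenpairE => //; split.
  (* The test vertex has index 1, where the entry is [s v0] without its phase. *)
  apply: contraNneq z_v0 => /ffunP/(_ (v0, Ordinal h_gt1)); rewrite !ffunE /=.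
  by move=> s0; rewrite -sK s0 expr0n gtn_eqF.
rewrite def_k1; apply: (phases_blob_eigvec (e := p) (s := s)) => //.
- by move=> v; rewrite -def_k expi_unity_root.
- by move=> v c; rewrite ffunE.
move=> v s_v; rewrite sK z_in; last first.
  by apply: contraR s_v => /z_out z0; rewrite /s z0 rootC0.
by congr (_ * _); apply: eq_bigr => u _; rewrite sK.
Qed.

Lemma gpower_HspectrumP (R : realType) (k : nat) (G : sgraph) (d : G -> R)
    (lam : R[i]) : (4 <= k)%N -> ~~ odd k ->
  Hspectrum (diag_tensor k (fun w : gpower_vertex G k => d w.1)
    + adjacency_tensor R k (gpower G k)) lam <->
  exists U : {set G}, connected (induced U) /\
    exists z, phased_eigvec (fun v => (d v)%:C%C) (fun=> 1) lam U z.
Proof.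
move=> k_ge4 k_even; have h_gt1 : (1 < k./2)%N by apply: (half_leq k_ge4).
have h_gt0 := ltnW h_gt1; have k_gt0 : (0 < k)%N by apply: leq_trans k_ge4.
have def_k : k = (k./2 * 2)%N by rewrite muln2 even_halfK.
have def_k1 : k.-1 = (k./2 * 2).-1 by rewrite -def_k.
split=> [[x /gpower_eigenpairE[] // x_neq0 eq_x x_real]|].
  have [w x_w] := ffun_neq0 x_neq0.
  rewrite def_k1 in eq_x.
  have [U [t [y [_ t1 y_neq0 y_out y_in]]]] :=
    blob_eigvec_phases h_gt0 (ex_intro _ w x_w) eq_x.
  apply: (@phased_eigvec_connected _ _ _ _ _ U y); split=> // v vU.
  rewrite y_in // t1 //; congr (_ * _).
  by apply: eq_bigr => u _; rewrite mul1r.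
case=> U [_ [z0 z0P]].
have d_real v : (d v)%:C%C \is Num.real by apply/complex_realP; exists (d v).
(* The given eigenvector may be complex; a real one is needed for its signs to serve as phases and
   for [x] to be real. *)
have [z [[v0 z_v0] z_out z_in] z_real] := real_eigvec d_real z0P.
pose e v : R[i] := if 0 <= z v then 1 else -1.
have zE v : z v = e v * `|z v|.
  rewrite /e; case: ifP => z_ge0; first by rewrite ger0_norm ?mul1r.
  by rewrite ltr0_norm ?mulN1r ?opprK // real_ltNge ?z_ge0.
have ee v : e v * e v = 1 by rewrite /e; case: ifP; rewrite ?mulrNN mulr1.
pose s v := (k./2).-root `|z v|.
have sK v : s v ^+ k./2 = `|z v| by rewrite rootCK.
have s_ge0 v : 0 <= s v by rewrite rootC_ge0.
pose x : {ffun gpower_vertex G k -> R[i]} :=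
  [ffun w : G * 'I_k./2 => if w.2 == 0 :> nat then e w.1 * s w.1 else s w.1].
exists x; last first.
  move=> w; rewrite ffunE; have s_real := ger0_real (s_ge0 w.1).
  by case: ifP => // _; rewrite rpredM // /e; case: ifP; rewrite ?rpredN rpred1.
apply/gpower_eigenpairE => //; split.
  apply: contraNneq z_v0 => /ffunP/(_ (v0, Ordinal h_gt1)); rewrite !ffunE /=.
  by move=> s0; rewrite -normr_eq0 -sK s0 expr0n gtn_eqF.
rewrite def_k1; apply: (phases_blob_eigvec (e := e) (s := s)) => //.
- by move=> v; rewrite mulnC exprM expr2 ee expr1n.
- by move=> v c; rewrite ffunE.
move=> v s_v; rewrite sK.
have vU : v \in U.
  by apply: contraR s_v => /z_out z_v; rewrite /s z_v normr0 rootC0.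
(* Since [e v * e v = 1], multiplying the equation of [z] by the sign [e v] turns [z v] into its
   absolute value on the left. *)
transitivity (e v * ((lam - (d v)%:C%C) * z v)).
  by rewrite {2}zE mulrCA [e v * (_ * _)]mulrA ee mul1r.
rewrite z_in // mul1r; congr (_ * _); apply: eq_bigr => u _.
by rewrite mul1r sK -zE.
Qed.

(** * Back to the matrices of the induced subgraphs *)

Lemma phased_pencil_spectrumP (R : realType) (k : nat) (G : sgraph)
    (U : {set G}) (d : G -> R[i]) (D : 'M[R[i]]_#|induced U|) (lam : R[i]) :
  (0 < k)%N ->
  (forall u v : induced U,
    D (enum_rank u) (enum_rank v) = d (val u) *+ (u == v)) ->
  (exists l : induced U -> 'I_k,
    mx_spectrum (D + phased_adjacency_mx R l) lam) <->
  exists (l : G -> 'I_k) z,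
    phased_eigvec d (fun v => expi (2 * pi * (l v)%:R / k%:R)) lam U z.
Proof.
move=> k_gt0 def_D; split=> -[l].
  (* Outside [U] the label 0 is a mere default: it only meets zero entries of [z]. *)
  pose l' v := if insub v is Some u then l (u : induced U) else Ordinal k_gt0.
  move/(mx_spectrum_phasedP (d := d)
    (e := fun v => expi (2 * pi * (l' v)%:R / k%:R))) => lam_l.
  exists l'; apply: lam_l => u v.
  by rewrite mxE def_D phased_adjacency_mxE /l' !valK.
case=> z zP; exists (fun u => l (val u)).
apply/(mx_spectrum_phasedP (d := d)
  (e := fun v => expi (2 * pi * (l v)%:R / k%:R))); last by exists z.
by move=> u v; rewrite mxE def_D phased_adjacency_mxE.
Qed.

Lemma pencil_spectrumP (F : numClosedFieldType) (G : sgraph) (U : {set G})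
    (d : G -> F) (D : 'M[F]_#|induced U|) (lam : F) :
  (forall u v : induced U,
    D (enum_rank u) (enum_rank v) = d (val u) *+ (u == v)) ->
  mx_spectrum (D + adjacency_mx F (induced U)) lam <->
  exists z, phased_eigvec d (fun=> 1) lam U z.
Proof.
move=> def_D; apply: mx_spectrum_phasedP => u v.
by rewrite mxE def_D adjacency_mxE mulr1 mul1r.
Qed.

Local Open Scope classical_set_scope.

Theorem theorem2p10 (R : realType) (k : nat) (G : sgraph)
    (k_ge4 : (4 <= k)%N) (k_even : ~~ odd k) :
  [/\ spectrum (adjacency_tensor R k (gpower G k)) =
        \bigcup_(U in [set U : {set G} | connected (induced U)])
          \bigcup_(l : induced U -> 'I_k)
            mx_spectrum (phased_adjacency_mx R l),
      spectrum (signless_laplacian_tensor R k (gpower G k)) =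
        \bigcup_(U in [set U : {set G} | loop_connected (modified_induced U)])
          \bigcup_(l : induced U -> 'I_k)
            mx_spectrum (phased_signless_laplacian_mx R l),
      Hspectrum (adjacency_tensor R k (gpower G k)) =
        \bigcup_(U in [set U : {set G} | connected (induced U)])
          mx_spectrum (adjacency_mx R[i] (induced U)) &
      Hspectrum (signless_laplacian_tensor R k (gpower G k)) =
        \bigcup_(U in [set U : {set G} | loop_connected (modified_induced U)])
          mx_spectrum (signless_laplacian_mx R[i] U)].
Proof.
have k_gt0 : (0 < k)%N by apply: leq_trans k_ge4.
have h_gt0 : (0 < k./2)%N by rewrite half_gt0 (leq_trans _ k_ge4).
pose zero (v : G) : R := 0.
pose deg (v : G) : R := (degree (edges G) v)%:R.
pose zeroC v : R[i] := (zero v)%:C%C; pose degC v : R[i] := (deg v)%:C%C.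
have zeroE : adjacency_tensor R k (gpower G k) =
    diag_tensor k (fun w : gpower_vertex G k => zero w.1)
    + adjacency_tensor R k (gpower G k) by rewrite diag_tensor0 add0r.
have degE : signless_laplacian_tensor R k (gpower G k) =
    diag_tensor k (fun w : gpower_vertex G k => deg w.1)
    + adjacency_tensor R k (gpower G k).
  congr (diag_tensor _ _ + _); apply/funext => w.
  by rewrite degree_gpower.
have zero_mxE (U : {set G}) (u v : induced U) :
    (0 : 'M[R[i]]_#|induced U|) (enum_rank u) (enum_rank v) =
    zeroC (val u) *+ (u == v).
  by rewrite mxE /zeroC rmorph0 mul0rn.
have deg_mxE (U : {set G}) (u v : induced U) :
    principal_submx (degree_mx R[i] G) U (enum_rank u) (enum_rank v) =
    degC (val u) *+ (u == v).
  by rewrite principal_degree_mxE /degC rmorph_nat.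
split.
- rewrite zeroE; apply/seteqP; split=> lam.
    case/(gpower_spectrumP zero lam k_ge4 k_even) => U [U_conn].
    case/(phased_pencil_spectrumP lam k_gt0 (zero_mxE U)) => l.
    by rewrite add0r => lam_l; exists U => //; exists l.
  case=> U U_conn [l _ lam_l]; apply/(gpower_spectrumP zero lam k_ge4 k_even).
  exists U; split=> //; apply/(phased_pencil_spectrumP lam k_gt0 (zero_mxE U)).
  by exists l; rewrite add0r.
- rewrite degE; apply/seteqP; split=> lam.
    (* [U_conn] also serves for the modified induced subgraph, whose connectedness is by definition
       that of [induced U]. *)
    case/(gpower_spectrumP deg lam k_ge4 k_even) => U [U_conn].
    case/(phased_pencil_spectrumP lam k_gt0 (deg_mxE U)) => l lam_l.
    by exists U => //; exists l.
  case=> U U_conn [l _ lam_l]; apply/(gpower_spectrumP deg lam k_ge4 k_even).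
  exists U; split=> //; apply/(phased_pencil_spectrumP lam k_gt0 (deg_mxE U)).
  by exists l.
- rewrite zeroE; apply/seteqP; split=> lam.
    case/(gpower_HspectrumP zero lam k_ge4 k_even) => U [U_conn].
    by move/(pencil_spectrumP lam (zero_mxE U)); rewrite add0r; exists U.
  case=> U U_conn lam_U; apply/(gpower_HspectrumP zero lam k_ge4 k_even).
  exists U; split=> //.
  by apply/(pencil_spectrumP lam (zero_mxE U)); rewrite add0r.
- rewrite degE; apply/seteqP; split=> lam.
    case/(gpower_HspectrumP deg lam k_ge4 k_even) => U [U_conn].
    by move/(pencil_spectrumP lam (deg_mxE U)); exists U.
  case=> U U_conn lam_U; apply/(gpower_HspectrumP deg lam k_ge4 k_even).
  exists U; split=> //.
  exact/(pencil_spectrumP lam (deg_mxE U)).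
Qed.
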